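(* Let $a\in\mathbb{C}$ with $|a|<1$. There exists an absolute constant $c>0$ such that for all $f\in C(\mathbb{T})$ and all integers $n\ge 2$, $$\|f-S_n^a(f)\|_\infty\le c\,\log n\; E_n^a(f)_\infty .$$
   Context: $\mathbb{T}=\mathbb{R}/2\pi\mathbb{Z}$; functions on $\mathbb{T}$ are real- or complex-valued and identified with $2\pi$-periodic functions on $\mathbb{R}$; $C(\mathbb{T})$ is the space of continuous ones and $\|\cdot\|_\infty$ the (essential) supremum norm. For $a=|a|e^{it_a}$, $|a|<1$, the nonlinear phase function $\theta_a:\mathbb{R}\to\mathbb{R}$ is the continuous function with $e^{i\theta_a(t)}=\dfrac{e^{it}-a}{1-\overline{a}e^{it}}$ (a fixed choice of continuous branch). It is strictly increasing, satisfies $\theta_a(t+2\pi)=\theta_a(t)+2\pi$, and has derivative the Poisson kernel $\theta_a'(t)=p_a(t)=\dfrac{1-|a|^2}{1-2|a|\cos(t-t_a)+|a|^2}$. For $f\in L^1(\mathbb{T})$, $c_k(f)=\dfrac1{2\pi}\displaystyle\int_{-\pi}^{\pi}f(t)e^{-ik\theta_a(t)}p_a(t)\,dt$ for $k\in\mathbb{Z}$, and $S_n^a(f)(x)=\displaystyle\sum_{k=-n}^{n}c_k(f)e^{ik\theta_a(x)}$. $\tau_n^a=\operatorname{span}\{e^{ik\theta_a(t)}:|k|\le n\}$ is the space of nonlinear trigonometric polynomials of degree at most $n$, and $E_n^a(f)_\infty=\inf_{T\in\tau_n^a}\|f-T\|_\infty$. *)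

(* Defs.v *)
(* Stdlib reals with Coquelicot. *)
From Stdlib Require Export Reals ZArith.
From Coquelicot Require Export Coquelicot.

Open Scope R_scope.

Definition cis (t : R) : C := (cos t, sin t).

(* C(T): functions on the circle are 2 PI-periodic functions on R.  They are
   complex-valued; real-valued functions are those with values in RtoC. *)
Definition C_circle (f : R -> C) : Prop :=
  (forall t : R, continuous f t) /\ (forall t : R, f (t + 2 * PI) = f t).

(* An element of [0, +oo], so that no finiteness is presupposed.  On continuous
   functions this is also the essential supremum norm. *)
Definition sup_norm (g : R -> C) : Rbar :=
  Lub_Rbar (fun y : R => exists t : R, y = Cmod (g t)).

(* The sum of u k over the integers k with -n <= k <= n; the summation index
   j of [sum_n] runs from 0 to 2 n inclusive. *)
Definition sum_sym (u : Z -> C) (n : nat) : C :=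
  sum_n (fun j : nat => u (Z.of_nat j - Z.of_nat n)%Z) (2 * n).

Definition is_phase (a : C) (theta : R -> R) : Prop :=
  (forall t : R, continuous theta t) /\
  (forall t : R,
     cis (theta t) = ((cis t - a) / (1 - Cconj a * cis t))%C).

(* ta is an argument of a. *)
Definition poisson (a : C) (ta t : R) : R :=
  (1 - Cmod a ^ 2) / (1 - 2 * Cmod a * cos (t - ta) + Cmod a ^ 2).

(* exp (i k theta t) *)
Definition nl_exp (theta : R -> R) (k : Z) (t : R) : C :=
  cis (IZR k * theta t).

Definition nl_coef (a : C) (ta : R) (theta : R -> R) (f : R -> C) (k : Z) : C :=
  (RtoC (/ (2 * PI)) *
   RInt (V := C_R_CompleteNormedModule)
     (fun t : R =>
        f t * nl_exp theta (- k) t * RtoC (poisson a ta t))%C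
     (- PI) PI)%C.

Definition nl_partial_sum (a : C) (ta : R) (theta : R -> R) (n : nat)
    (f : R -> C) (x : R) : C :=
  sum_sym (fun k : Z => nl_coef a ta theta f k * nl_exp theta k x)%C n.

(* The complex span of exp (i k theta), |k| <= n. *)
Definition nl_trig_poly (theta : R -> R) (n : nat) (T : R -> C) : Prop :=
  exists b : Z -> C,
    forall t : R, T t = sum_sym (fun k : Z => b k * nl_exp theta k t)%C n.

Definition best_approx (theta : R -> R) (n : nat) (f : R -> C) : Rbar :=
  Rbar_glb (fun y : Rbar =>
    exists T : R -> C,
      nl_trig_poly theta n T /\ y = sup_norm (fun t : R => f t - T t)%C).

(* Main.v *)
Require Import Defs.
From Stdlib Require Import Lra Lia.

(** This is Lebesgue's inequality after the change of variable [u = theta t].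

    Every branch [theta] of the phase differs by a constant from the closed
    formula [explicit_phase] ([phase_shift]).  Hence [theta] has derivative
    [poisson] and increases by [2 PI] over a period.  Two facts follow.

    First, the functions [cis (k theta)] are orthonormal for the weight
    [poisson / (2 PI)] ([is_RInt_cis_phase]), so the partial sum of order [n]
    reproduces every [T] in the span ([nl_partial_sum_nl_trig_poly]).  By
    linearity the error for [f] equals the error for [g = f - T].

    Secondly, the partial sum of [g] at [x] is the integral of [g t] against
    [D_n (theta x - theta t) poisson t / (2 PI)], with [D_n] the Dirichlet kernel
    ([is_RInt_nl_partial_sum]).  Substituting [u = theta t], the integral of the
    absolute value of this kernel is that of [|D_n|] over a period
    ([is_RInt_dirichlet_phase]), whatever the parameter [a]; this is why the
    constant is absolute.  The bound [|D_n v| <= 9 n / (1 + n |v|)]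
    ([Cmod_dirichlet_decay]) makes that integral at most a multiple of [ln n]
    ([RInt_dirichlet_le]).

    So the error for [f] is at most [14 ln n] times the supremum of [|f - T|], and
    it remains to take the infimum over [T] ([Rbar_le_mult_glb]). *)

(** * Unimodular numbers *)

Lemma cis_add (s t : R) : cis (s + t) = (cis s * cis t)%C.
Proof.
  unfold cis, Cmult; simpl; rewrite cos_plus, sin_plus; f_equal; ring.
Qed.

Lemma cis_0 : cis 0 = 1%C.
Proof. unfold cis; now rewrite cos_0, sin_0. Qed.

Lemma Cmod_cis (t : R) : Cmod (cis t) = 1.
Proof.
  unfold Cmod, cis; simpl.
  replace (cos t * (cos t * 1) + sin t * (sin t * 1)) with 1.
  - exact sqrt_1.
  - generalize (sin2_cos2 t); unfold Rsqr; lra.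
Qed.

Lemma Cconj_cis (t : R) : Cconj (cis t) = cis (- t).
Proof. unfold Cconj, cis; simpl; now rewrite cos_neg, sin_neg. Qed.

Lemma cis_period (t : R) : cis (t + 2 * PI) = cis t.
Proof.
  unfold cis; rewrite cos_plus, sin_plus, cos_2PI, sin_2PI.
  apply injective_projections; simpl; ring.
Qed.

Lemma cis_period_Z (m : Z) (t : R) : cis (t + IZR m * (2 * PI)) = cis t.
Proof.
  assert (Hn : forall (k : nat) (s : R), cis (s + INR k * (2 * PI)) = cis s).
  { induction k as [|k IH]; intros s.
    - simpl; f_equal; ring.
    - rewrite S_INR, <- (IH s), <- (cis_period (s + INR k * (2 * PI))).
      f_equal; ring. }
  destruct (Z_le_gt_dec 0 m) as [Hm|Hm].
  - rewrite <- (Z2Nat.id m Hm), <- INR_IZR_INZ; apply Hn.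
  - rewrite <- (Hn (Z.to_nat (- m)) (t + IZR m * (2 * PI))).
    rewrite INR_IZR_INZ, Z2Nat.id, opp_IZR by lia; f_equal; ring.
Qed.

(** [1 + i y] has argument [atan y]; dividing it by its conjugate removes the
    modulus and doubles the argument. *)
Lemma cis_2atan (y : R) : cis (2 * atan y) = Cdiv (1, y) (1, - y).
Proof.
  assert (Hy : 0 < 1 + y * y) by nra.
  assert (Hs : sqrt (1 + y * y) * sqrt (1 + y * y) = 1 + y * y) by (apply sqrt_sqrt; lra).
  assert (Hp : 0 < sqrt (1 + y * y)) by now apply sqrt_lt_R0.
  unfold cis. rewrite cos_2a, sin_2a, cos_atan, sin_atan.
  unfold Rsqr. set (w := sqrt (1 + y * y)) in *.
  replace (1 / w * (1 / w)) with (/ (w * w)) by (field; lra).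
  replace (y / w * (y / w)) with (y * y / (w * w)) by (field; lra).
  replace (2 * (y / w) * (1 / w)) with (2 * y / (w * w)) by (field; lra).
  rewrite Hs. unfold Cdiv, Cinv, Cmult; simpl.
  f_equal; field; nra.
Qed.

(** * Continuity of complex-valued functions *)

(** The topology of [C] is that of the product [R * R]. *)
Lemma continuous_C (f : R -> C) (t : R) :
  continuous (fun s => fst (f s)) t -> continuous (fun s => snd (f s)) t ->
  continuous f t.
Proof.
  intros H1 H2 P [eps HP].
  assert (L1 := H1 _ (locally_ball (fst (f t)) eps)).
  assert (L2 := H2 _ (locally_ball (snd (f t)) eps)).
  unfold filtermap in *.
  generalize (filter_and _ _ L1 L2); apply filter_imp.
  intros s [A B]; apply HP; split; assumption.
Qed.

Lemma continuous_Re (f : R -> C) (t : R) :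
  continuous f t -> continuous (fun s => fst (f s)) t.
Proof.
  intros H; apply (continuous_comp f fst); [exact H|].
  destruct (f t); apply continuous_fst.
Qed.

Lemma continuous_Im (f : R -> C) (t : R) :
  continuous f t -> continuous (fun s => snd (f s)) t.
Proof.
  intros H; apply (continuous_comp f snd); [exact H|].
  destruct (f t); apply continuous_snd.
Qed.

Lemma continuous_Cmult (f g : R -> C) (t : R) :
  continuous f t -> continuous g t -> continuous (fun s => f s * g s)%C t.
Proof.
  intros Hf Hg; apply continuous_C; simpl.
  - apply (continuous_minus (fun s => fst (f s) * fst (g s)) (fun s => snd (f s) * snd (g s)));
    apply (@continuous_mult _ R_AbsRing); auto using continuous_Re, continuous_Im.
  - apply (continuous_plus (fun s => fst (f s) * snd (g s)) (fun s => snd (f s) * fst (g s)));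
    apply (@continuous_mult _ R_AbsRing); auto using continuous_Re, continuous_Im.
Qed.

Lemma continuous_RtoC (g : R -> R) (t : R) :
  continuous g t -> continuous (fun s => RtoC (g s)) t.
Proof.
  intros H; apply continuous_C; [exact H | apply continuous_const].
Qed.

Lemma continuous_cis_comp (g : R -> R) (t : R) :
  continuous g t -> continuous (fun s => cis (g s)) t.
Proof.
  intros H; apply continuous_C; simpl;
  [apply continuous_cos_comp | apply continuous_sin_comp]; exact H.
Qed.

(** * The nonlinear phase and its derivative *)

(** The Blaschke factor is [cis t] times the unimodular quotient of
    [1 - r cis (- s)] by its conjugate, where [s = t - ta].  Since [0 < 1 - r cos s],
    the principal argument of [1 - r cis (- s)] is a smooth function of [t], and
    twice it, added to [t], is a global branch of the phase. *)
Definition explicit_phase (r ta t : R) : R :=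
  t + 2 * atan (r * sin (t - ta) / (1 - r * cos (t - ta))).

Lemma poisson_denominators_pos (r s : R) :
  0 <= r < 1 -> 0 < 1 - r * cos s /\ 0 < 1 - 2 * r * cos s + r ^ 2.
Proof.
  intros Hr; generalize (COS_bound s); intros [H1 H2]; split; nra.
Qed.

Lemma cis_explicit_phase (r ta t : R) :
  0 <= r < 1 ->
  cis (explicit_phase r ta t) =
  ((cis t - RtoC r * cis ta) / (1 - Cconj (RtoC r * cis ta) * cis t))%C.
Proof.
  intros Hr. unfold explicit_phase.
  destruct (poisson_denominators_pos r (t - ta) Hr) as [H1 H2].
  rewrite cis_add, cis_2atan.
  rewrite Cmult_conj, Cconj_cis.
  replace (Cconj (RtoC r)) with (RtoC r)
    by (unfold Cconj, RtoC; simpl; f_equal; ring).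
  assert (E : (RtoC r * cis (- ta) * cis t)%C = (RtoC r * cis (t - ta))%C).
  { rewrite <- Cmult_assoc, <- cis_add; do 2 f_equal; ring. }
  rewrite E.
  assert (E2 : (cis t - RtoC r * cis ta)%C = (cis t * (1 - RtoC r * cis (- (t - ta))))%C).
  { replace (cis ta) with (cis t * cis (- (t - ta)))%C
      by (rewrite <- cis_add; f_equal; ring). ring. }
  rewrite E2. set (s := t - ta) in *.
  unfold Cdiv. rewrite <- Cmult_assoc. f_equal.
  (* Write 1 - r cis (-+ s) as d (1 +- i y), y being the argument of atan. *)
  set (d := 1 - r * cos s) in *.
  replace (1 - RtoC r * cis (- s))%C with (Cmult (RtoC d) (1, r * sin s / d)).
  2: { unfold cis, RtoC, Cmult, Cminus, Cplus, Copp; simpl.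
       rewrite cos_neg, sin_neg. f_equal; unfold d; field; unfold d in H1; lra. }
  replace (1 - RtoC r * cis s)%C with (Cmult (RtoC d) (1, - (r * sin s / d))).
  2: { unfold cis, RtoC, Cmult, Cminus, Cplus, Copp; simpl.
       f_equal; unfold d; field; unfold d in H1; lra. }
  assert (RtoC d <> 0%C) by (intros K; apply RtoC_inj in K; lra).
  assert ((1, - (r * sin s / d)) <> 0%C :> C) by (intros K; injection K; lra).
  field; split; assumption.
Qed.

Lemma is_derive_explicit_phase (a : C) (ta t : R) :
  Cmod a < 1 -> is_derive (explicit_phase (Cmod a) ta) t (poisson a ta t).
Proof.
  intros Ha. assert (Hr : 0 <= Cmod a < 1) by (split; [apply Cmod_ge_0 | assumption]).
  destruct (poisson_denominators_pos (Cmod a) (t - ta) Hr) as [H1 H2].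
  unfold explicit_phase, poisson. set (r := Cmod a) in *.
  auto_derive; [change (t + - ta) with (t - ta); lra|].
  change (t + - ta) with (t - ta). generalize (sin2_cos2 (t - ta)).
  unfold Rsqr; set (S := sin _) in *; set (c := cos _) in *; intros HSC.
  assert (Hq : (1 - r * c) ^ 2 + r ^ 2 * S ^ 2 = 1 - 2 * r * c + r ^ 2) by nra.
  replace (1 + r * S * / (1 - r * c) * (r * S * / (1 - r * c) * 1)) with 
   ((1 - 2 * r * c + r ^ 2) / (1 - r * c) ^ 2) by (rewrite <- Hq; field; lra).
  assert (HS : S * S = 1 - c * c) by lra.
  field_simplify_eq; [|repeat split; lra].
  replace (S ^ 2) with (1 - c * c) by (rewrite <- HS; ring). ring.
Qed.

Lemma explicit_phase_period (r ta t : R) :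
  explicit_phase r ta (t + 2 * PI) = explicit_phase r ta t + 2 * PI.
Proof.
  unfold explicit_phase.
  assert (E := cis_period (t - ta)).
  injection E as E1 E2.
  replace (t + 2 * PI - ta) with (t - ta + 2 * PI) by ring.
  rewrite E1, E2; ring.
Qed.

(** A continuous lift is determined up to a constant: by the intermediate value
    theorem it cannot jump between the discrete solutions of [cis w = c0]. *)
Lemma continuous_cis_const (w : R -> R) (c0 : C) :
  (forall t, continuous w t) -> (forall t, cis (w t) = c0) -> forall t, w t = w 0.
Proof.
  intros Hc Hw t.
  assert (Hcont : continuity w).
  { intros s; apply continuity_pt_filterlim; apply Hc. }
  destruct (Req_dec (w t) (w 0)) as [E|E]; [exact E | exfalso].
  (* A value of w at distance at most 1 from w 0: a multiple of 2 PI that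
     close to 0 can only be 0. *)
  pose (y := w 0 + Rmax (-1) (Rmin 1 (w t - w 0))).
  assert (Hy : Rmin (w 0) (w t) <= y <= Rmax (w 0) (w t) /\ -1 <= y - w 0 <= 1 /\ y <> w 0).
  { unfold y, Rmax, Rmin. repeat destruct Rle_dec; lra. }
  destruct Hy as (Hy1 & Hy2 & Hy3).
  destruct (IVT_gen w 0 t y Hcont Hy1) as [s [_ Hs]].
  assert (K : cis (y - w 0) = 1%C).
  { unfold Rminus; rewrite cis_add, <- Hs, Hw, <- (Hw 0), <- cis_add, Rplus_opp_r.
    apply cis_0. }
  assert (Hsin : sin (y - w 0) = 0) by (injection K; trivial).
  generalize PI2_3_2; intros HPI.
  destruct (Rle_lt_dec (y - w 0) 0) as [L|L].
  - assert (0 < sin (- (y - w 0))) by (apply sin_gt_0; lra). rewrite sin_neg in H; lra.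
  - assert (0 < sin (y - w 0)) by (apply sin_gt_0; lra); lra.
Qed.

(** This makes every result on the given branch a computation with the closed
    formula: its derivative and its increment over a period are those of
    [explicit_phase]. *)
Lemma phase_shift (a : C) (ta : R) (theta : R -> R) :
  Cmod a < 1 -> a = (RtoC (Cmod a) * cis ta)%C -> is_phase a theta ->
  exists k : R, forall t, theta t = explicit_phase (Cmod a) ta t + k.
Proof.
  intros Ha Hta [Hc Ht].
  assert (Hr : 0 <= Cmod a < 1) by (split; [apply Cmod_ge_0 | assumption]).
  exists (theta 0 - explicit_phase (Cmod a) ta 0). intros t.
  cut (theta t - explicit_phase (Cmod a) ta t = theta 0 - explicit_phase (Cmod a) ta 0); [lra|].
  apply (continuous_cis_const (fun t => theta t - explicit_phase (Cmod a) ta t) 1).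
  - intros s; apply (continuous_minus (V := R_NormedModule)); [apply Hc|].
    apply (ex_derive_continuous (V := R_NormedModule)).
    eexists; now apply is_derive_explicit_phase.
  - intros s; unfold Rminus; rewrite cis_add, Ht.
    rewrite Hta at 1 2. rewrite <- (cis_explicit_phase _ _ _ Hr), <- cis_add, Rplus_opp_r.
    apply cis_0.
Qed.

Lemma is_derive_phase (a : C) (ta : R) (theta : R -> R) (t : R) :
  Cmod a < 1 -> a = (RtoC (Cmod a) * cis ta)%C -> is_phase a theta ->
  is_derive theta t (poisson a ta t).
Proof.
  intros Ha Hta Hth. destruct (phase_shift _ _ _ Ha Hta Hth) as [k Hk].
  apply (is_derive_ext (fun t => plus (explicit_phase (Cmod a) ta t) k)).
  { intros s; now rewrite Hk. }
  rewrite <- (plus_zero_r (poisson a ta t)).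
  apply (is_derive_plus (V := R_NormedModule)).
  - now apply is_derive_explicit_phase.
  - apply (is_derive_const (V := R_NormedModule)).
Qed.

Lemma phase_period (a : C) (ta : R) (theta : R -> R) (t : R) :
  Cmod a < 1 -> a = (RtoC (Cmod a) * cis ta)%C -> is_phase a theta ->
  theta (t + 2 * PI) = theta t + 2 * PI.
Proof.
  intros Ha Hta Hth. destruct (phase_shift _ _ _ Ha Hta Hth) as [k Hk].
  rewrite !Hk, explicit_phase_period; ring.
Qed.

Lemma continuous_poisson (a : C) (ta t : R) :
  Cmod a < 1 -> continuous (poisson a ta) t.
Proof.
  intros Ha. assert (Hr : 0 <= Cmod a < 1) by (split; [apply Cmod_ge_0 | assumption]).
  destruct (poisson_denominators_pos (Cmod a) (t - ta) Hr) as [H1 H2].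
  apply (ex_derive_continuous (V := R_NormedModule)); unfold poisson. auto_derive.
  simpl in H2; unfold Rminus in *; lra.
Qed.

Lemma poisson_pos (a : C) (ta t : R) : Cmod a < 1 -> 0 < poisson a ta t.
Proof.
  intros Ha. assert (Hr : 0 <= Cmod a < 1) by (split; [apply Cmod_ge_0 | assumption]).
  destruct (poisson_denominators_pos (Cmod a) (t - ta) Hr) as [H1 H2].
  apply Rdiv_lt_0_compat; [nra | exact H2].
Qed.

(** * Finite sums *)

Lemma sum_n_ext_C (u v : nat -> C) (m : nat) :
  (forall j, u j = v j) -> sum_n u m = sum_n v m.
Proof. apply sum_n_ext. Qed.

Lemma sum_n_Cmult_l (c : C) (u : nat -> C) (m : nat) :
  sum_n (fun j => c * u j)%C m = (c * sum_n u m)%C.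
Proof. exact (sum_n_mult_l (K := C_Ring) c u m). Qed.

Lemma sum_sym_ext (u v : Z -> C) (n : nat) :
  (forall k, u k = v k) -> sum_sym u n = sum_sym v n.
Proof. intros H; apply sum_n_ext; intros j; apply H. Qed.

Lemma sum_sym_ext_bounded (u v : Z -> C) (n : nat) :
  (forall k, (- Z.of_nat n <= k <= Z.of_nat n)%Z -> u k = v k) -> sum_sym u n = sum_sym v n.
Proof. intros H; apply sum_n_ext_loc; intros j Hj; apply H; lia. Qed.

Lemma sum_sym_Cmult_l (c : C) (u : Z -> C) (n : nat) :
  sum_sym (fun k => c * u k)%C n = (c * sum_sym u n)%C.
Proof. apply sum_n_Cmult_l. Qed.

Lemma sum_sym_plus (u v : Z -> C) (n : nat) :
  sum_sym (fun k => u k + v k)%C n = (sum_sym u n + sum_sym v n)%C.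
Proof. exact (sum_n_plus (G := C_AbelianGroup) _ _ _). Qed.

(** Evaluates the sum of Fourier coefficients of an element of the span. *)
Lemma sum_sym_delta (u : Z -> C) (n : nat) (k : Z) :
  (- Z.of_nat n <= k <= Z.of_nat n)%Z ->
  sum_sym (fun l => if Z.eq_dec l k then u l else RtoC 0) n = u k.
Proof.
  intros Hk.
  (* The index l = k sits at position k + n, and enters once m reaches it. *)
  assert (H : forall m,
    sum_n (fun j => if Z.eq_dec (Z.of_nat j - Z.of_nat n) k
                    then u (Z.of_nat j - Z.of_nat n)%Z else RtoC 0) m =
    if Z_le_dec (k + Z.of_nat n) (Z.of_nat m) then u k else RtoC 0).
  { induction m as [|m IH].
    - rewrite sum_O. destruct Z.eq_dec as [<-|]; destruct Z_le_dec; try lia; reflexivity.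
    - rewrite sum_Sn, IH.
      destruct Z.eq_dec as [<-|]; destruct Z_le_dec; destruct Z_le_dec; try lia;
        first [exact (Cplus_0_l _) | exact (Cplus_0_r _)]. }
  unfold sum_sym; rewrite H. destruct Z_le_dec; [reflexivity | lia].
Qed.

Lemma Cmod_sum_n_le (u : nat -> C) (M : R) (m : nat) :
  (forall j, Cmod (u j) <= M) -> Cmod (sum_n u m) <= INR (S m) * M.
Proof.
  intros Hu; induction m as [|m IH].
  - rewrite sum_O; simpl; rewrite Rmult_1_l; apply Hu.
  - rewrite sum_Sn, S_INR. eapply Rle_trans; [apply Cmod_triangle|].
    specialize (Hu (S m)); lra.
Qed.

Lemma continuous_sum_n_C (u : nat -> R -> C) (m : nat) (t : R) :
  (forall j, continuous (u j) t) -> continuous (fun s => sum_n (fun j => u j s) m) t.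
Proof.
  intros Hu; induction m as [|m IH].
  - apply (continuous_ext (u 0%nat)); [|apply Hu].
    intros s; now rewrite sum_O.
  - apply (continuous_ext (fun s => plus (sum_n (fun j => u j s) m) (u (S m) s))).
    + intros s; now rewrite sum_Sn.
    + apply (continuous_plus (V := C_R_NormedModule)); [exact IH | apply Hu].
Qed.

(** * The Dirichlet kernel and its Lebesgue constant *)

Definition dirichlet (n : nat) (v : R) : C :=
  sum_sym (fun k => cis (IZR k * v)) n.

Lemma dirichlet_period (n : nat) (v : R) :
  dirichlet n (v + 2 * PI) = dirichlet n v.
Proof.
  apply sum_sym_ext; intros k.
  rewrite Rmult_plus_distr_l; apply cis_period_Z.
Qed.

Lemma continuous_dirichlet_comp (n : nat) (g : R -> R) (t : R) :
  continuous g t -> continuous (fun s => dirichlet n (g s)) t.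
Proof.
  intros Hg; unfold dirichlet, sum_sym.
  apply (continuous_sum_n_C (fun j s => cis (IZR (Z.of_nat j - Z.of_nat n) * g s))).
  intros j; apply continuous_cis_comp.
  apply (@continuous_mult _ R_AbsRing); [apply continuous_const | exact Hg].
Qed.

Lemma continuous_Cmod_dirichlet_comp (n : nat) (g : R -> R) (t : R) :
  continuous g t -> continuous (fun s => Cmod (dirichlet n (g s))) t.
Proof.
  intros Hg. apply (continuous_comp (fun u => dirichlet n (g u)) Cmod).
  - now apply continuous_dirichlet_comp.
  - eapply continuous_ext; [intros z; symmetry; apply Cmod_norm|].
    apply (filterlim_norm (V := C_R_NormedModule)).
Qed.

Lemma Cmod_dirichlet_le (n : nat) (v : R) :
  Cmod (dirichlet n v) <= 2 * INR n + 1.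
Proof.
  eapply Rle_trans.
  - apply (Cmod_sum_n_le _ 1); intros j; rewrite Cmod_cis; lra.
  - rewrite S_INR, mult_INR; simpl (INR 2). lra.
Qed.

(** The factor is [2 i sin (v / 2)]; multiplying by it makes the geometric sum
    telescope, which avoids dividing by a quantity that may vanish. *)
Lemma dirichlet_mul_sin (n : nat) (v : R) :
  (dirichlet n v * (cis (v / 2) - cis (- (v / 2))))%C =
  (cis ((INR n + / 2) * v) - cis (- ((INR n + / 2) * v)))%C.
Proof.
  assert (H : forall m,
    (sum_n (fun j => cis (IZR (Z.of_nat j - Z.of_nat n) * v)) m *
       (cis (v / 2) - cis (- (v / 2))))%C =
    (cis ((INR m - INR n + / 2) * v) - cis (- ((INR n + / 2) * v)))%C).
  { assert (E : forall j : nat,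
      (cis (IZR (Z.of_nat j - Z.of_nat n) * v) * (cis (v / 2) - cis (- (v / 2))))%C =
      (cis ((INR j - INR n + / 2) * v) - cis ((INR j - INR n - / 2) * v))%C).
    { intros j. rewrite minus_IZR, <- !INR_IZR_INZ.
      replace ((INR j - INR n + / 2) * v) with ((INR j - INR n) * v + v / 2) by field.
      replace ((INR j - INR n - / 2) * v) with ((INR j - INR n) * v + - (v / 2)) by field.
      rewrite !cis_add; ring. }
    induction m as [|m IH].
    - rewrite sum_O, E. f_equal; f_equal; f_equal; simpl; field.
    - rewrite sum_Sn. change plus with Cplus.
      rewrite Cmult_plus_distr_r, IH, E, S_INR.
      replace (INR m + 1 - INR n - / 2) with (INR m - INR n + / 2) by field. ring. }
  unfold dirichlet, sum_sym; rewrite H, mult_INR.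
  do 3 f_equal. simpl; ring.
Qed.

Lemma Cmod_dirichlet_sin_le (n : nat) (v : R) :
  Cmod (dirichlet n v) * Rabs (sin (v / 2)) <= 1.
Proof.
  assert (E := f_equal Cmod (dirichlet_mul_sin n v)).
  rewrite Cmod_mult in E.
  replace (Cmod (cis (v / 2) - cis (- (v / 2)))) with (2 * Rabs (sin (v / 2))) in E.
  2: { replace (cis (v / 2) - cis (- (v / 2)))%C with (Ci * RtoC (2 * sin (v / 2)))%C.
       - rewrite Cmod_mult, Cmod_R, Rabs_mult, (Rabs_right 2) by lra.
         replace (Cmod Ci) with 1; [ring|].
         unfold Cmod, Ci; simpl; symmetry; transitivity (sqrt 1); [f_equal; ring | apply sqrt_1].
       - unfold cis; rewrite cos_neg, sin_neg.
         unfold Ci, RtoC, Cmult, Cminus, Cplus, Copp; simpl.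
         apply injective_projections; simpl; ring. }
  assert (L := Cmod_triangle (cis ((INR n + / 2) * v)) (- cis (- ((INR n + / 2) * v)))%C).
  rewrite Cmod_opp, !Cmod_cis in L. unfold Cminus in E. lra.
Qed.

(** Taylor: [sin x >= x - x ^ 3 / 6], and [x ^ 2 / 6 <= 2 / 3]. *)
Lemma sin_ge_third (x : R) : 0 <= x <= 2 -> x / 3 <= sin x.
Proof.
  intros Hx. destruct (pre_sin_bound x 0) as [H _]; [lra|lra|].
  unfold sin_approx, sin_term in H; simpl in H. nra.
Qed.

Lemma abs_le_sin_half (v : R) : Rabs v <= PI -> Rabs v <= 6 * Rabs (sin (v / 2)).
Proof.
  intros Hv. assert (P := PI_4).
  unfold Rabs in Hv at 1. unfold Rabs at 1. destruct (Rcase_abs v) as [N|N].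
  - assert (L := sin_ge_third (- (v / 2))). rewrite sin_neg in L.
    assert (- sin (v / 2) <= Rabs (sin (v / 2))) by (rewrite <- Rabs_Ropp; apply Rle_abs). lra.
  - assert (L := sin_ge_third (v / 2)).
    assert (sin (v / 2) <= Rabs (sin (v / 2))) by apply Rle_abs. lra.
Qed.

(** One majorant valid on the whole period, of height about [n] near [0] and
    decaying like [1 / |v|]: its integral is logarithmic in [n] and no case
    distinction at [|v| = 1 / n] is required. *)
Lemma Cmod_dirichlet_decay (n : nat) (v : R) :
  (1 <= n)%nat -> Rabs v <= PI ->
  Cmod (dirichlet n v) <= 9 * INR n / (1 + INR n * Rabs v).
Proof.
  intros Hn Hv. apply le_INR in Hn; simpl in Hn.
  assert (H1 := Cmod_dirichlet_le n v). assert (H2 := Cmod_dirichlet_sin_le n v).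
  assert (H3 := abs_le_sin_half v Hv). assert (H4 := Cmod_ge_0 (dirichlet n v)).
  assert (H5 := Rabs_pos v).
  assert (H6 : 0 < 1 + INR n * Rabs v) by nra.
  apply (Rmult_le_reg_r (1 + INR n * Rabs v)); [exact H6|].
  replace (9 * INR n / (1 + INR n * Rabs v) * (1 + INR n * Rabs v)) with (9 * INR n)
    by (field; lra).
  (* The decay 6 / |v| and the trivial bound 2 n + 1 <= 3 n, combined. *)
  assert (H7 : Cmod (dirichlet n v) * Rabs v <= 6) by nra.
  nra.
Qed.

Lemma ln_1_plus_nPI_le (n : nat) : (2 <= n)%nat -> ln (1 + INR n * PI) <= 4 * ln (INR n).
Proof.
  intros Hn. apply le_INR in Hn; simpl in Hn. assert (P := PI_4). assert (P' := PI_RGT_0).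
  replace (4 * ln (INR n)) with (ln (INR n ^ 4))
    by (rewrite ln_pow by lra; simpl; ring).
  (* 1 + 4 n <= 8 n <= n ^ 4 for n >= 2. *)
  apply ln_le; [nra|].
  assert (INR n ^ 2 >= 4) by nra. assert (INR n ^ 3 >= 8) by nra. nra.
Qed.

(** The Lebesgue constant of the classical Fourier series grows at most
    logarithmically. *)
Lemma RInt_dirichlet_le (n : nat) (x : R) :
  (2 <= n)%nat ->
  RInt (fun u => Cmod (dirichlet n (x - u))) (x - PI) (x + PI) <= 72 * ln (INR n).
Proof.
  intros Hn. assert (Hln := ln_1_plus_nPI_le n Hn).
  assert (Hn1 : (1 <= n)%nat) by lia. assert (Hn' := Hn).
  apply le_INR in Hn; simpl in Hn.
  assert (P := PI_RGT_0).
  set (h := fun u => Cmod (dirichlet n (x - u))).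
  assert (Hc : forall t, continuous h t).
  { intros t; apply continuous_Cmod_dirichlet_comp.
    apply (continuous_minus (V := R_NormedModule));
      [apply continuous_const | apply continuous_id]. }
  assert (Hex : forall y z, ex_RInt h y z).
  { intros y z; apply (ex_RInt_continuous (V := R_CompleteNormedModule)); auto. }
  (* Each half has a majorant with a logarithmic antiderivative. *)
  rewrite <- (RInt_Chasles h (x - PI) x (x + PI)) by apply Hex.
  assert (L : is_RInt (fun u => 9 * INR n / (1 + INR n * (x - u))) (x - PI) x
                (minus (- 9 * ln (1 + INR n * (x - x))) (- 9 * ln (1 + INR n * (x - (x - PI)))))).
  { apply (is_RInt_derive (V := R_CompleteNormedModule)
             (fun u => - 9 * ln (1 + INR n * (x - u)))).
    - intros u. rewrite Rmin_left, Rmax_right by lra. intros Hu.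
      assert (0 < 1 + INR n * (x - u)) by nra.
      auto_derive; [unfold Rminus in *; lra|]. field; lra.
    - intros u. rewrite Rmin_left, Rmax_right by lra. intros Hu.
      assert (0 < 1 + INR n * (x - u)) by nra.
      apply (ex_derive_continuous (V := R_NormedModule)). auto_derive.
      unfold Rminus in *; lra. }
  assert (U : is_RInt (fun u => 9 * INR n / (1 + INR n * (u - x))) x (x + PI)
                (minus (9 * ln (1 + INR n * (x + PI - x))) (9 * ln (1 + INR n * (x - x))))).
  { apply (is_RInt_derive (V := R_CompleteNormedModule)
             (fun u => 9 * ln (1 + INR n * (u - x)))).
    - intros u. rewrite Rmin_left, Rmax_right by lra. intros Hu.
      assert (0 < 1 + INR n * (u - x)) by nra.
      auto_derive; [unfold Rminus in *; lra|]. field; lra.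
    - intros u. rewrite Rmin_left, Rmax_right by lra. intros Hu.
      assert (0 < 1 + INR n * (u - x)) by nra.
      apply (ex_derive_continuous (V := R_NormedModule)). auto_derive.
      unfold Rminus in *; lra. }
  assert (BL := is_RInt_le h _ (x - PI) x _ _ ltac:(lra) (RInt_correct _ _ _ (Hex _ _)) L).
  assert (BU := is_RInt_le h _ x (x + PI) _ _ ltac:(lra) (RInt_correct _ _ _ (Hex _ _)) U).
  rewrite Rminus_diag, Rmult_0_r, Rplus_0_r, ln_1 in BL, BU.
  replace (x - (x - PI)) with PI in BL by ring.
  replace (x + PI - x) with PI in BU by ring.
  unfold minus, plus, opp in *; simpl in *.
  assert (BL' : RInt h (x - PI) x <= 9 * ln (1 + INR n * PI)).
  { eapply Rle_trans; [apply BL|lra]. intros u Hu; unfold h.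
    rewrite <- (Rabs_right (x - u)) at 2 by lra.
    apply Cmod_dirichlet_decay; [assumption|]. rewrite Rabs_right; lra. }
  assert (BU' : RInt h x (x + PI) <= 9 * ln (1 + INR n * PI)).
  { eapply Rle_trans; [apply BU|lra]. intros u Hu; unfold h.
    replace (u - x) with (Rabs (x - u)) by (rewrite Rabs_left; lra).
    apply Cmod_dirichlet_decay; [assumption|]. rewrite Rabs_left; lra. }
  lra.
Qed.

(** * Integrals *)

Lemma RInt_period (h : R -> R) (p A : R) :
  (forall t, continuous h t) -> (forall t, h (t + p) = h t) ->
  forall B, RInt h A (A + p) = RInt h B (B + p).
Proof.
  intros Hc Hp B.
  assert (Hex : forall x y, ex_RInt h x y).
  { intros x y; apply (ex_RInt_continuous (V := R_CompleteNormedModule)); auto. }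
  assert (E1 := RInt_Chasles h A B (B + p) (Hex _ _) (Hex _ _)).
  assert (E2 := RInt_Chasles h A (A + p) (B + p) (Hex _ _) (Hex _ _)).
  assert (E3 : RInt h (A + p) (B + p) = RInt h A B).
  { assert (L := RInt_comp_lin h 1 p A B (Hex _ _)).
    rewrite !Rmult_1_l in L. rewrite <- L. apply RInt_ext; intros x _.
    change (scal 1 (h (1 * x + p))) with (1 * h (1 * x + p)).
    now rewrite !Rmult_1_l, Hp. }
  unfold plus in *; simpl in *. lra.
Qed.

Lemma is_RInt_derive_eq_ends (F f : R -> R) (x y : R) :
  (forall t, is_derive F t (f t)) -> (forall t, continuous f t) -> F x = F y ->
  is_RInt f x y 0.
Proof.
  intros HF Hf E. replace 0 with (F y - F x) by (rewrite E; ring).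
  apply (is_RInt_derive (V := R_CompleteNormedModule)); auto.
Qed.

Lemma is_RInt_ext_C (f g : R -> C) (x y : R) (l : C) :
  (forall t, f t = g t) ->
  is_RInt (V := C_R_NormedModule) f x y l -> is_RInt (V := C_R_NormedModule) g x y l.
Proof. intros H; apply is_RInt_ext; intros t _; apply H. Qed.

(** [is_RInt] is linear over [R] only; complex scalars are handled through real
    and imaginary parts. *)
Lemma is_RInt_Cmult_l (c : C) (f : R -> C) (x y : R) (l : C) :
  is_RInt (V := C_R_NormedModule) f x y l ->
  is_RInt (V := C_R_NormedModule) (fun t => c * f t)%C x y (c * l)%C.
Proof.
  intros H.
  assert (H1 := is_RInt_fct_extend_fst f x y l H).
  assert (H2 := is_RInt_fct_extend_snd f x y l H).
  apply (is_RInt_fct_extend_pair (U := R_NormedModule) (V := R_NormedModule)); simpl.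
  - apply (is_RInt_minus (V := R_NormedModule) (fun t => fst c * fst (f t)) (fun t => snd c * snd (f t)));
    apply (is_RInt_scal (V := R_NormedModule)); assumption.
  - apply (is_RInt_plus (V := R_NormedModule) (fun t => fst c * snd (f t)) (fun t => snd c * fst (f t)));
    apply (is_RInt_scal (V := R_NormedModule)); assumption.
Qed.

Lemma is_RInt_sum_n_C (u : nat -> R -> C) (I : nat -> C) (x y : R) (m : nat) :
  (forall j, is_RInt (V := C_R_NormedModule) (u j) x y (I j)) ->
  is_RInt (V := C_R_NormedModule) (fun t => sum_n (fun j => u j t) m) x y (sum_n I m).
Proof.
  intros Hu; induction m as [|m IH].
  - rewrite sum_O. apply (is_RInt_ext (u 0%nat)); [|apply Hu].
    intros t _; now rewrite sum_O.
  - rewrite sum_Sn.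
    apply (is_RInt_ext (fun t => plus (sum_n (fun j => u j t) m) (u (S m) t))).
    + intros t _; now rewrite sum_Sn.
    + apply (is_RInt_plus (V := C_R_NormedModule)); [exact IH | apply Hu].
Qed.

(** * Fourier coefficients with respect to the phase *)

Lemma continuous_nl_exp (theta : R -> R) (k : Z) (t : R) :
  continuous theta t -> continuous (nl_exp theta k) t.
Proof.
  intros H; apply continuous_cis_comp.
  apply (@continuous_mult _ R_AbsRing); [apply continuous_const | exact H].
Qed.

Lemma RtoC_2PI_cancel (z : C) : (RtoC (/ (2 * PI)) * (RtoC (2 * PI) * z))%C = z.
Proof.
  assert (P := PI_RGT_0).
  now rewrite Cmult_assoc, <- RtoC_mult, Rinv_l, Cmult_1_l by lra.
Qed.

Lemma nl_coef_unique (a : C) (ta : R) (theta : R -> R) (f : R -> C) (k : Z) (l : C) :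
  is_RInt (V := C_R_NormedModule)
    (fun t => f t * nl_exp theta (- k) t * RtoC (poisson a ta t))%C (- PI) PI l ->
  nl_coef a ta theta f k = (RtoC (/ (2 * PI)) * l)%C.
Proof.
  intros H; unfold nl_coef; f_equal.
  apply (is_RInt_unique (V := C_R_CompleteNormedModule)); exact H.
Qed.

Lemma is_RInt_nl_coef (a : C) (ta : R) (theta : R -> R) (f : R -> C) (k : Z) :
  Cmod a < 1 -> (forall t, continuous theta t) -> (forall t, continuous f t) ->
  is_RInt (V := C_R_NormedModule)
    (fun t => f t * nl_exp theta (- k) t * RtoC (poisson a ta t))%C (- PI) PI
    (RtoC (2 * PI) * nl_coef a ta theta f k)%C.
Proof.
  intros Ha Hth Hf.
  assert (P := PI_RGT_0).
  unfold nl_coef. rewrite Cmult_assoc, <- RtoC_mult, Rinv_r, Cmult_1_l by lra.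
  apply (RInt_correct (V := C_R_CompleteNormedModule)).
  apply (ex_RInt_continuous (V := C_R_CompleteNormedModule)); intros t _.
  apply continuous_Cmult; [apply continuous_Cmult|].
  - apply Hf.
  - apply continuous_nl_exp, Hth.
  - apply continuous_RtoC, continuous_poisson, Ha.
Qed.

Lemma nl_coef_ext (a : C) (ta : R) (theta : R -> R) (f g : R -> C) (k : Z) :
  (forall t, f t = g t) -> nl_coef a ta theta f k = nl_coef a ta theta g k.
Proof.
  intros H; unfold nl_coef; f_equal.
  apply (RInt_ext (V := C_R_CompleteNormedModule)); intros t _; now rewrite H.
Qed.

Lemma nl_coef_plus (a : C) (ta : R) (theta : R -> R) (f g : R -> C) (k : Z) :
  Cmod a < 1 -> (forall t, continuous theta t) ->
  (forall t, continuous f t) -> (forall t, continuous g t) ->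
  nl_coef a ta theta (fun t => f t + g t)%C k =
  (nl_coef a ta theta f k + nl_coef a ta theta g k)%C.
Proof.
  intros Ha Hth Hf Hg.
  assert (If := is_RInt_nl_coef a ta theta f k Ha Hth Hf).
  assert (Ig := is_RInt_nl_coef a ta theta g k Ha Hth Hg).
  assert (I := is_RInt_plus (V := C_R_NormedModule) _ _ _ _ _ _ If Ig).
  rewrite <- (RtoC_2PI_cancel (_ + _)%C). apply nl_coef_unique.
  rewrite Cmult_plus_distr_l.
  revert I; apply is_RInt_ext_C; intros t.
  change plus with Cplus; ring.
Qed.

Lemma nl_coef_Cmult_l (a : C) (ta : R) (theta : R -> R) (c : C) (f : R -> C) (k : Z) :
  Cmod a < 1 -> (forall t, continuous theta t) -> (forall t, continuous f t) ->
  nl_coef a ta theta (fun t => c * f t)%C k = (c * nl_coef a ta theta f k)%C.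
Proof.
  intros Ha Hth Hf.
  assert (I := is_RInt_Cmult_l c _ _ _ _ (is_RInt_nl_coef a ta theta f k Ha Hth Hf)).
  rewrite <- (RtoC_2PI_cancel (_ * _)%C). apply nl_coef_unique.
  replace (RtoC (2 * PI) * (c * nl_coef a ta theta f k))%C with
    (c * (RtoC (2 * PI) * nl_coef a ta theta f k))%C by ring.
  revert I; apply is_RInt_ext_C; intros t. ring.
Qed.

Lemma nl_coef_sum_n (a : C) (ta : R) (theta : R -> R) (u : nat -> R -> C) (k : Z) (m : nat) :
  Cmod a < 1 -> (forall t, continuous theta t) ->
  (forall j t, continuous (u j) t) ->
  nl_coef a ta theta (fun t => sum_n (fun j => u j t) m) k =
  sum_n (fun j => nl_coef a ta theta (u j) k) m.
Proof.
  intros Ha Hth Hu; induction m as [|m IH].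
  - rewrite sum_O; apply nl_coef_ext; intros t; now rewrite sum_O.
  - rewrite sum_Sn, <- IH. change plus with Cplus.
    rewrite <- nl_coef_plus; auto.
    + apply nl_coef_ext; intros t; now rewrite sum_Sn.
    + intros t; apply continuous_sum_n_C; auto.
Qed.

(** Orthogonality of the system [nl_exp theta k] for the weight [poisson]: as
    [poisson] is the derivative of [theta], the integrand has the antiderivative
    [cis (m theta) / (i m)], which takes equal values at the two ends because
    [theta] increases by [2 PI]; for [m = 0] the antiderivative is [theta]. *)
Lemma is_RInt_cis_phase (a : C) (ta : R) (theta : R -> R) (m : Z) :
  Cmod a < 1 -> a = (RtoC (Cmod a) * cis ta)%C -> is_phase a theta ->
  is_RInt (V := C_R_NormedModule)
    (fun t => cis (IZR m * theta t) * RtoC (poisson a ta t))%C (- PI) PI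
    (if Z.eq_dec m 0 then RtoC (2 * PI) else RtoC 0).
Proof.
  intros Ha Hta Hth.
  assert (Hc := proj1 Hth).
  assert (Hper : theta PI = theta (- PI) + 2 * PI).
  { rewrite <- (phase_period a ta theta) by assumption. f_equal; ring. }
  assert (HP : forall t, continuous (poisson a ta) t) by (intros; now apply continuous_poisson).
  assert (HD := fun t => is_derive_phase a ta theta t Ha Hta Hth).
  destruct Z.eq_dec as [->|Hm].
  - apply (is_RInt_ext_C (fun t => RtoC (poisson a ta t))).
    + intros t. rewrite Rmult_0_l, cis_0. symmetry; apply Cmult_1_l.
    + apply (is_RInt_fct_extend_pair (U := R_NormedModule) (V := R_NormedModule)); simpl.
      * replace (2 * PI) with (minus (theta PI) (theta (- PI)))
          by (rewrite Hper; unfold minus, plus, opp; simpl; ring).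
        apply (is_RInt_derive (V := R_CompleteNormedModule)); auto.
      * assert (I := is_RInt_const (V := R_NormedModule) (- PI) PI 0).
        change (scal (PI - - PI) 0) with ((PI - - PI) * 0) in I.
        rewrite Rmult_0_r in I; exact I.
  - assert (Hm' : IZR m <> 0) by now apply not_0_IZR.
    assert (E := cis_period_Z m (IZR m * theta (- PI))).
    rewrite <- Rmult_plus_distr_l, <- Hper in E. injection E as Ec Es.
    apply (is_RInt_fct_extend_pair (U := R_NormedModule) (V := R_NormedModule)); simpl.
    + apply (is_RInt_derive_eq_ends (fun t => sin (IZR m * theta t) / IZR m)); [| |now rewrite Es].
      * intros t. auto_derive; [eexists; apply HD|].
        replace (Derive (fun s : R => theta s) t) with (poisson a ta t)
          by (symmetry; apply is_derive_unique, HD).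
        field; assumption.
      * intros t.
        apply (continuous_minus (V := R_NormedModule)); apply (@continuous_mult _ R_AbsRing); auto.
        -- apply continuous_cos_comp, (@continuous_mult _ R_AbsRing); [apply continuous_const | apply Hc].
        -- apply continuous_sin_comp, (@continuous_mult _ R_AbsRing); [apply continuous_const | apply Hc].
        -- apply continuous_const.
    + apply (is_RInt_derive_eq_ends (fun t => - cos (IZR m * theta t) / IZR m)); [| |now rewrite Ec].
      * intros t. auto_derive; [eexists; apply HD|].
        replace (Derive (fun s : R => theta s) t) with (poisson a ta t)
          by (symmetry; apply is_derive_unique, HD).
        field; assumption.
      * intros t.
        apply (continuous_plus (V := R_NormedModule)); apply (@continuous_mult _ R_AbsRing); auto.
        -- apply continuous_cos_comp, (@continuous_mult _ R_AbsRing); [apply continuous_const | apply Hc].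
        -- apply continuous_const.
        -- apply continuous_sin_comp, (@continuous_mult _ R_AbsRing); [apply continuous_const | apply Hc].
Qed.

Lemma nl_coef_nl_exp (a : C) (ta : R) (theta : R -> R) (l k : Z) :
  Cmod a < 1 -> a = (RtoC (Cmod a) * cis ta)%C -> is_phase a theta ->
  nl_coef a ta theta (nl_exp theta l) k = if Z.eq_dec l k then RtoC 1 else RtoC 0.
Proof.
  intros Ha Hta Hth.
  assert (I := is_RInt_cis_phase a ta theta (l - k) Ha Hta Hth).
  rewrite (nl_coef_unique a ta theta _ k (if Z.eq_dec (l - k) 0 then RtoC (2 * PI) else RtoC 0)).
  - rewrite <- (RtoC_2PI_cancel (if Z.eq_dec l k then _ else _)). f_equal.
    destruct Z.eq_dec; destruct Z.eq_dec; try lia; ring.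
  - revert I; apply is_RInt_ext_C; intros t.
    unfold nl_exp; rewrite <- cis_add, minus_IZR, opp_IZR. do 2 f_equal; ring.
Qed.

(** * Partial sums *)

Lemma continuous_nl_trig_poly (theta : R -> R) (n : nat) (T : R -> C) (t : R) :
  continuous theta t -> nl_trig_poly theta n T -> continuous T t.
Proof.
  intros Hth [b Hb].
  apply (continuous_ext (fun t => sum_sym (fun k : Z => b k * nl_exp theta k t)%C n)).
  { intros s; now rewrite Hb. }
  apply (continuous_sum_n_C (fun j s => b (Z.of_nat j - Z.of_nat n)%Z *
            nl_exp theta (Z.of_nat j - Z.of_nat n) s)%C).
  intros j; apply continuous_Cmult; [apply continuous_const | now apply continuous_nl_exp].
Qed.

(** The partial sum operator is a projection onto the span, which is what brings
    in the best approximation. *)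
Lemma nl_partial_sum_nl_trig_poly (a : C) (ta : R) (theta : R -> R) (n : nat) (T : R -> C) (x : R) :
  Cmod a < 1 -> a = (RtoC (Cmod a) * cis ta)%C -> is_phase a theta ->
  nl_trig_poly theta n T -> nl_partial_sum a ta theta n T x = T x.
Proof.
  intros Ha Hta Hth [b Hb]. assert (Hc := proj1 Hth).
  unfold nl_partial_sum. rewrite Hb. apply sum_sym_ext_bounded; intros k Hk. f_equal.
  rewrite (nl_coef_ext _ _ _ _ _ _ Hb).
  rewrite <- (sum_sym_delta b n k Hk) at 1. unfold sum_sym.
  rewrite nl_coef_sum_n; auto.
  - apply sum_n_ext_C; intros j.
    rewrite nl_coef_Cmult_l; auto using continuous_nl_exp.
    rewrite nl_coef_nl_exp by assumption.
    destruct Z.eq_dec; ring.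
  - intros j t; apply continuous_Cmult; [apply continuous_const | apply continuous_nl_exp, Hc].
Qed.

Lemma nl_partial_sum_plus (a : C) (ta : R) (theta : R -> R) (n : nat) (f g : R -> C) (x : R) :
  Cmod a < 1 -> (forall t, continuous theta t) ->
  (forall t, continuous f t) -> (forall t, continuous g t) ->
  nl_partial_sum a ta theta n (fun t => f t + g t)%C x =
  (nl_partial_sum a ta theta n f x + nl_partial_sum a ta theta n g x)%C.
Proof.
  intros Ha Hth Hf Hg. unfold nl_partial_sum. rewrite <- sum_sym_plus.
  apply sum_sym_ext; intros k. rewrite nl_coef_plus by assumption. ring.
Qed.

(** Dirichlet's formula: [cis (k theta x) cis (- k theta t)] depends only on
    [theta x - theta t], so the sum over [k] may be taken inside the integral. *)
Lemma is_RInt_nl_partial_sum (a : C) (ta : R) (theta : R -> R) (n : nat) (f : R -> C) (x : R) :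
  Cmod a < 1 -> (forall t, continuous theta t) -> (forall t, continuous f t) ->
  is_RInt (V := C_R_NormedModule)
    (fun t => f t * (dirichlet n (theta x - theta t) * RtoC (poisson a ta t)))%C (- PI) PI
    (RtoC (2 * PI) * nl_partial_sum a ta theta n f x)%C.
Proof.
  intros Ha Hth Hf. unfold nl_partial_sum. rewrite <- sum_sym_Cmult_l.
  pose (kk := fun j => (Z.of_nat j - Z.of_nat n)%Z).
  assert (I := is_RInt_sum_n_C
    (fun j t => nl_exp theta (kk j) x *
       (f t * nl_exp theta (- kk j) t * RtoC (poisson a ta t)))%C
    (fun j => nl_exp theta (kk j) x * (RtoC (2 * PI) * nl_coef a ta theta f (kk j)))%C
    (- PI) PI (2 * n) (fun j => is_RInt_Cmult_l _ _ _ _ _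
        (is_RInt_nl_coef a ta theta f (kk j) Ha Hth Hf))).
  unfold sum_sym at 1.
  rewrite (sum_n_ext_C _ (fun j => nl_exp theta (kk j) x *
      (RtoC (2 * PI) * nl_coef a ta theta f (kk j)))%C) by (intros j; unfold kk; ring).
  revert I; apply is_RInt_ext_C; intros t.
  rewrite (sum_n_ext_C _ (fun j => (f t * RtoC (poisson a ta t)) *
      cis (IZR (kk j) * (theta x - theta t)))%C).
  - rewrite sum_n_Cmult_l.
    change (sum_n _ _) with (dirichlet n (theta x - theta t)). ring.
  - intros j. unfold nl_exp.
    replace (IZR (kk j) * (theta x - theta t)) with
      (IZR (kk j) * theta x + IZR (- kk j) * theta t) by (rewrite opp_IZR; ring).
    rewrite cis_add; ring.
Qed.

(** Substituting [u = theta t] absorbs the weight and leaves the classical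
    Lebesgue constant, the interval of integration being any full period. *)
Lemma is_RInt_dirichlet_phase (a : C) (ta : R) (theta : R -> R) (n : nat) (x : R) :
  Cmod a < 1 -> a = (RtoC (Cmod a) * cis ta)%C -> is_phase a theta ->
  is_RInt (fun t => poisson a ta t * Cmod (dirichlet n (theta x - theta t))) (- PI) PI
    (RInt (fun u => Cmod (dirichlet n (theta x - u))) (theta x - PI) (theta x + PI)).
Proof.
  intros Ha Hta Hth.
  set (h := fun u => Cmod (dirichlet n (theta x - u))).
  assert (Hh : forall u, continuous h u).
  { intros u; apply continuous_Cmod_dirichlet_comp.
    apply (continuous_minus (V := R_NormedModule)); [apply continuous_const | apply continuous_id]. }
  assert (Hp : forall u, h (u + 2 * PI) = h u).
  { intros u; unfold h. rewrite <- (dirichlet_period n (theta x - (u + 2 * PI))).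
    do 2 f_equal; ring. }
  assert (E := RInt_period h (2 * PI) (theta (- PI)) Hh Hp (theta x - PI)).
  replace (theta x - PI + 2 * PI) with (theta x + PI) in E by ring.
  rewrite <- (phase_period a ta theta) in E by assumption.
  replace (- PI + 2 * PI) with PI in E by ring.
  rewrite <- E.
  apply (is_RInt_comp (V := R_CompleteNormedModule) h theta (poisson a ta)).
  - intros; apply Hh.
  - intros t _; split; [now apply is_derive_phase | now apply continuous_poisson].
Qed.

Lemma Cmod_nl_partial_sum_le (a : C) (ta : R) (theta : R -> R) (n : nat)
    (g : R -> C) (M x : R) :
  Cmod a < 1 -> a = (RtoC (Cmod a) * cis ta)%C -> is_phase a theta ->
  (2 <= n)%nat -> (forall t, continuous g t) -> (forall t, Cmod (g t) <= M) ->
  Cmod (nl_partial_sum a ta theta n g x) <= 12 * ln (INR n) * M.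
Proof.
  intros Ha Hta Hth Hn Hg HM.
  assert (I := is_RInt_nl_partial_sum a ta theta n g x Ha (proj1 Hth) Hg).
  assert (J := is_RInt_scal _ _ _ M _ (is_RInt_dirichlet_phase a ta theta n x Ha Hta Hth)).
  assert (B := RInt_dirichlet_le n (theta x) Hn).
  assert (P := PI2_3_2).
  assert (M0 : 0 <= M) by (eapply Rle_trans; [apply Cmod_ge_0 | apply (HM 0)]).
  assert (Hle : forall t, Cmod (g t * (dirichlet n (theta x - theta t) *
      RtoC (poisson a ta t))) <=
      M * (poisson a ta t * Cmod (dirichlet n (theta x - theta t)))).
  { intros t. assert (0 < poisson a ta t) by now apply poisson_pos.
    rewrite !Cmod_mult, Cmod_R, Rabs_right, (Rmult_comm (poisson a ta t)) by lra.
    apply Rmult_le_compat_r; [|apply HM].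
    apply Rmult_le_pos; [apply Cmod_ge_0 | lra]. }
  assert (N := norm_RInt_le (V := C_R_NormedModule) _ _ (- PI) PI _ _ ltac:(lra)
    (fun t _ => eq_ind _ (fun z => z <= _) (Hle t) _ (Cmod_norm _)) I J).
  rewrite <- Cmod_norm, Cmod_mult, Cmod_R, Rabs_right in N by lra.
  set (L := RInt _ _ _) in *. change (scal M L) with (M * L) in N.
  assert (C0 := Cmod_ge_0 (nl_partial_sum a ta theta n g x)).
  (* 72 / (2 PI) <= 12 because 3 < PI. *)
  assert (M * L <= M * (72 * ln (INR n))) by now apply Rmult_le_compat_l.
  nra.
Qed.

(** * Suprema, infima and the inequality *)

Lemma sup_norm_le (g : R -> C) (B : Rbar) :
  (forall t, Rbar_le (Cmod (g t)) B) -> Rbar_le (sup_norm g) B.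
Proof.
  intros H; apply Lub_Rbar_correct. intros y [t ->]; apply H.
Qed.

Lemma Cmod_le_sup_norm (g : R -> C) (t : R) : Rbar_le (Cmod (g t)) (sup_norm g).
Proof.
  apply Lub_Rbar_correct; now exists t.
Qed.

(** Multiplication by [K > 0] is an order automorphism of the extended line, also
    at infinite values. *)
Lemma Rbar_le_mult_glb (K : R) (A : Rbar) (E : Rbar -> Prop) :
  0 < K -> (forall y, E y -> Rbar_le A (Rbar_mult K y)) ->
  Rbar_le A (Rbar_mult K (Rbar_glb E)).
Proof.
  intros HK H.
  assert (HK' : 0 < / K) by now apply Rinv_0_lt_compat.
  pose (k := mkposreal K HK). pose (k' := mkposreal (/ K) HK').
  assert (Ek : forall y, Rbar_mult K y = Rbar_mult_pos y k).
  { intros y; rewrite Rbar_mult_comm. apply is_Rbar_mult_unique.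
    destruct y as [y| |]; [reflexivity | now apply is_Rbar_mult_p_infty_pos
                          | now apply is_Rbar_mult_m_infty_pos]. }
  assert (Kk : forall y, Rbar_mult_pos (Rbar_mult_pos y k) k' = y).
  { intros [y| |]; simpl; try reflexivity. f_equal; field; lra. }
  rewrite Ek. apply (Rbar_mult_pos_le _ _ k'). rewrite Kk.
  unfold Rbar_glb; destruct (Rbar_ex_glb E) as [l Hl]; simpl; apply Hl.
  intros y Hy. rewrite <- (Kk y). apply Rbar_mult_pos_le. rewrite <- Ek. now apply H.
Qed.

Theorem theorem2 :
  exists c : R, 0 < c /\
    forall (a : C) (ta : R) (theta : R -> R),
      Cmod a < 1 ->
      a = (RtoC (Cmod a) * cis ta)%C ->
      is_phase a theta ->
      forall (f : R -> C) (n : nat),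
        C_circle f ->
        (2 <= n)%nat ->
        Rbar_le
          (sup_norm (fun x : R => f x - nl_partial_sum a ta theta n f x)%C)
          (Rbar_mult (Finite (c * ln (INR n))) (best_approx theta n f)).
Proof.
  (* 12 bounds the partial sum of g, and 2 absorbs g itself as 1 <= 2 ln 2. *)
  exists 14; split; [lra|].
  intros a ta theta Ha Hta Hth f n [Hf _] Hn.
  assert (Hln : / 2 < ln (INR n)).
  { eapply Rlt_le_trans; [apply ln_lt_2|]. apply ln_le; [lra|].
    apply le_INR in Hn; simpl in Hn; lra. }
  apply Rbar_le_mult_glb; [lra|].
  intros y [T [HT ->]].
  set (g := fun t => (f t - T t)%C).
  assert (HTc : forall t, continuous T t).
  { intros t; apply (continuous_nl_trig_poly theta n); [apply (proj1 Hth) | exact HT]. }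
  assert (Hg : forall t, continuous g t).
  { intros t; apply (continuous_minus (V := C_R_NormedModule)); auto. }
  assert (Hb := Cmod_le_sup_norm g).
  destruct (sup_norm g) as [M| |].
  - apply sup_norm_le; intros x; simpl in *.
    (* T is its own partial sum, so it drops out of the error. *)
    assert (E : (f x - nl_partial_sum a ta theta n f x)%C =
                (g x - nl_partial_sum a ta theta n g x)%C).
    { assert (L := nl_partial_sum_plus a ta theta n T g x Ha (proj1 Hth) HTc Hg).
      rewrite (nl_partial_sum_nl_trig_poly a ta theta n T) in L by assumption.
      assert (L' : nl_partial_sum a ta theta n f x =
                   nl_partial_sum a ta theta n (fun t => T t + g t)%C x).
      { apply sum_sym_ext; intros k. f_equal. apply nl_coef_ext; intros t; unfold g; ring. }
      rewrite L', L; unfold g; ring. }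
    rewrite E; unfold Cminus.
    eapply Rle_trans; [apply Cmod_triangle|]. rewrite Cmod_opp.
    assert (B := Cmod_nl_partial_sum_le a ta theta n g M x Ha Hta Hth Hn Hg Hb).
    assert (Bx := Hb x). assert (C0 := Cmod_ge_0 (g x)). nra.
  - assert (E : Rbar_mult (14 * ln (INR n)) p_infty = p_infty).
    { apply is_Rbar_mult_unique, is_Rbar_mult_sym, is_Rbar_mult_p_infty_pos; simpl; lra. }
    rewrite E; now destruct (sup_norm _).
  - destruct (Hb 0).
Qed.
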